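(* Let $X$ be a regular curve and let $f:X\to X$ be a homeomorphism. Then the map $\omega_f:X\to 2^X$, $x\mapsto\omega_f(x)$, is continuous at every point $x\in X$ whose $\omega$-limit set $\omega_f(x)$ is infinite.
   Context: A continuum is a nonempty connected compact metric space. A continuum $X$ is a regular curve if for each $x\in X$ and each open neighborhood $V$ of $x$ in $X$ there is an open neighborhood $U$ of $x$ in $X$ with $U\subset V$ and with finite boundary $\partial U$. $2^X$ denotes the hyperspace of all nonempty closed subsets of $X$, endowed with the Hausdorff metric $d_H(A,B)=\max\{\sup_{x\in A}d(x,B),\sup_{y\in B}d(y,A)\}$. The $\omega$-limit set of $x$ is $\omega_f(x)=\{y\in X:\exists\, n_i\in\mathbb{N},\ n_i\to\infty,\ \lim_{i\to\infty}d(f^{n_i}(x),y)=0\}$; it is nonempty and closed. *)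

(* Defs.v *)
From HB Require Import structures.
From mathcomp Require Import all_boot all_order all_algebra.
From mathcomp Require Import all_classical all_reals.
From mathcomp Require Import topology normedtype sequences.

Set Implicit Arguments.
Unset Strict Implicit.
Unset Printing Implicit Defensive.

Import Order.TTheory GRing.Theory Num.Theory.
Import numFieldNormedType.Exports.

Local Open Scope classical_set_scope.
Local Open Scope ring_scope.

Definition boundary (T : topologicalType) (A : set T) : set T :=
  closure A `\` interior A.

Definition homeomorphism (S T : topologicalType) (f : S -> T) : Prop :=
  continuous f /\
  exists g : T -> S, [/\ cancel f g, cancel g f & continuous g].

(* `metricType` does not require a point: nonemptiness has to be stated. *)
Definition continuum (R : realType) (X : metricType R) : Prop :=
  [/\ [set: X] !=set0, connected [set: X] & compact [set: X]].

Definition regular_curve (R : realType) (X : metricType R) : Prop :=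
  continuum X /\
  forall (x : X) (V : set X), open_nbhs x V ->
    exists U : set X,
      [/\ open_nbhs x U, U `<=` V & finite_set (boundary U)].

Lemma regular_curve_compact (R : realType) (X : metricType R) :
  regular_curve X -> compact [set: X].
Proof. by case=> -[]. Qed.

Definition dist_to (R : realType) (X : metricType R) (x : X) (A : set X) : R :=
  inf [set mdist x a | a in A].

Definition hausdorff_dist (R : realType) (X : metricType R) (A B : set X) : R :=
  Num.max (sup [set dist_to x B | x in A]) (sup [set dist_to y A | y in B]).

Section hausdorff_dist_theory.
Context (R : realType) (X : metricType R).
Implicit Types (x y : X) (A B C : set X).

Lemma dist_to_lb x A : has_lbound [set mdist x a | a in A].
Proof. by exists 0 => _ [a _ <-]; exact: mdist_ge0. Qed.

Lemma dist_to_le x a A : A a -> dist_to x A <= mdist x a.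
Proof. by move=> Aa; apply: ge_inf; [exact: dist_to_lb|exists a]. Qed.

Lemma dist_to_ge0 x A : 0 <= dist_to x A.
Proof.
have [->|/set0P[a Aa]] := eqVneq A set0.
  by rewrite /dist_to image_set0 inf0.
apply: lb_le_inf; first by exists (mdist x a), a.
by move=> _ [b _ <-]; exact: mdist_ge0.
Qed.

Lemma dist_to_lt x A (r : R) : A !=set0 -> dist_to x A < r ->
  exists2 a, A a & mdist x a < r.
Proof.
move=> [a0 Aa0] xAr; have [||_ [a Aa <-] ar] := @inf_lt R [set mdist x a | a in A] r.
- by exists (mdist x a0), a0.
- exact: xAr.
- by exists a.
Qed.

Lemma dist_to0 x A : closed A -> A !=set0 -> dist_to x A = 0 -> A x.
Proof.
move=> cA A0 xA0; apply: cA => B /nbhs_ballP[e /= e0 xeB].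
have [||a Aa xa] := @dist_to_lt x A e; [by []|by rewrite xA0|].
by exists a; split => //; apply: xeB; rewrite ballEmdist.
Qed.

Hypothesis cX : compact [set: X].

Lemma compact_mdist_bounded : exists M : R, forall x y, mdist x y <= M.
Proof.
have [[x0 _]|X0] := pselect ([set: X] !=set0); last first.
  by exists 0 => x; exfalso; apply: X0; exists x.
have [M [_ x0M]] : \forall M \near +oo, forall x, mdist x0 x <= M.
  have /compact_near_coveringP/(_ R +oo%R (fun M x => mdist x0 x <= M)) := cX.
  move=> /(_ _)[x _|M [Mr x0M]].
  - exists (ball x 1, [set M | mdist x0 x + 1 < M]) => /=.
      split; first exact: nbhsx_ballx.
      by exists (mdist x0 x + 1); split; [exact: num_real|].
    move=> [y M] /= []; rewrite ballEmdist /= => xy xM.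
    rewrite (le_trans (metric_triangle x0 x y))// (le_trans _ (ltW xM))//.
    by rewrite lerD2l ltW.
  - by exists M; split=> // N MN x; exact: x0M.
have {}x0M x : mdist x0 x <= M + 1 by apply: x0M; rewrite ltrDl.
exists ((M + 1) *+ 2) => x y.
by rewrite (le_trans (metric_triangle x x0 y))// mulr2n lerD// metric_sym.
Qed.

Lemma hausdorff_dist_ub A B x : B !=set0 -> A x ->
  dist_to x B <= hausdorff_dist A B.
Proof.
move=> [b Bb] Ax; have [M dM] := compact_mdist_bounded.
rewrite /hausdorff_dist le_max; apply/orP; left.
apply: ub_le_sup; last by exists x.
by exists M => _ [y _ <-]; exact: le_trans (dist_to_le _ Bb) (dM _ _).
Qed.

Lemma hausdorff_distC A B : hausdorff_dist A B = hausdorff_dist B A.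
Proof. by rewrite /hausdorff_dist maxC. Qed.

Lemma hausdorff_dist_le A B (r : R) : A !=set0 -> B !=set0 ->
  (forall x, A x -> dist_to x B <= r) ->
  (forall y, B y -> dist_to y A <= r) -> hausdorff_dist A B <= r.
Proof.
move=> [a Aa] [b Bb] AB BA; rewrite /hausdorff_dist ge_max; apply/andP; split.
  by apply: ge_sup => [|_ [x Ax <-]]; [exists (dist_to a B), a|exact: AB].
by apply: ge_sup => [|_ [x Ax <-]]; [exists (dist_to b A), b|exact: BA].
Qed.

Lemma hausdorff_dist_ge0 A B : A !=set0 -> B !=set0 -> 0 <= hausdorff_dist A B.
Proof.
by move=> [a Aa] B0; exact: le_trans (dist_to_ge0 a B) (hausdorff_dist_ub B0 Aa).
Qed.

Lemma hausdorff_distxx A : A !=set0 -> hausdorff_dist A A = 0.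
Proof.
move=> A0; apply/eqP; rewrite eq_le hausdorff_dist_ge0// andbT.
by apply: hausdorff_dist_le => // x Ax; rewrite -(mdistxx x) dist_to_le.
Qed.

Lemma hausdorff_dist_eq0 A B : A !=set0 -> B !=set0 -> closed A -> closed B ->
  hausdorff_dist A B = 0 -> A = B.
Proof.
move=> A0 B0 clA clB AB0; apply/seteqP; split => x.
  move=> Ax; apply: dist_to0 => //; apply/eqP.
  by rewrite eq_le dist_to_ge0 andbT -AB0 hausdorff_dist_ub.
move=> Bx; apply: dist_to0 => //; apply/eqP.
by rewrite eq_le dist_to_ge0 andbT -AB0 hausdorff_distC hausdorff_dist_ub.
Qed.

Lemma hausdorff_dist_triangle B A C : A !=set0 -> B !=set0 -> C !=set0 ->
  hausdorff_dist A C <= hausdorff_dist A B + hausdorff_dist B C.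
Proof.
have half P Q S x : Q !=set0 -> S !=set0 -> P x ->
    dist_to x S <= hausdorff_dist P Q + hausdorff_dist Q S.
  move=> Q0 S0 Px; apply/ler_addgt0Pr => e e0.
  have e20 : 0 < e / 2 by rewrite divr_gt0.
  have [||q Qq xq] := @dist_to_lt x Q (hausdorff_dist P Q + e / 2) => //.
    by rewrite (le_lt_trans (hausdorff_dist_ub Q0 Px))// ltrDl.
  have [||s Ss qs] := @dist_to_lt q S (hausdorff_dist Q S + e / 2) => //.
    by rewrite (le_lt_trans (hausdorff_dist_ub S0 Qq))// ltrDl.
  rewrite (le_trans (dist_to_le x Ss))// (le_trans (metric_triangle x q s))//.
  by rewrite [in leRHS](splitr e) addrACA lerD// ltW.
move=> A0 B0 C0; apply: hausdorff_dist_le => // [x Ax|y Cy]; first exact: half.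
by rewrite addrC (hausdorff_distC A) (hausdorff_distC B); exact: half.
Qed.

End hausdorff_dist_theory.

(* Compactness of X is a parameter because the metric structure below needs
   the suprema in `hausdorff_dist` to be taken over bounded sets. *)
Definition hyperspace (R : realType) (X : metricType R)
    (cX : compact [set: X]) : Type :=
  {A : set X | A !=set0 /\ closed A}.

Section hyperspace_metric.
Context (R : realType) (X : metricType R) (cX : compact [set: X]).
Local Notation H := (hyperspace cX).

HB.instance Definition _ := gen_eqMixin H.
HB.instance Definition _ := gen_choiceMixin H.

Definition hyperspace_dist (A B : H) : R := hausdorff_dist (sval A) (sval B).

Lemma hyperspace_distxx (A : H) : hyperspace_dist A A = 0.
Proof. by case: A => A [A0 clA]; exact: hausdorff_distxx. Qed.

Lemma hyperspace_dist_eq0 (A B : H) : hyperspace_dist A B = 0 -> A = B.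
Proof.
case: A B => [A [A0 clA]] [B [B0 clB]] /= AB; apply: eq_exist.
exact: hausdorff_dist_eq0 AB.
Qed.

Lemma hyperspace_distC (A B : H) : hyperspace_dist A B = hyperspace_dist B A.
Proof. exact: hausdorff_distC. Qed.

Lemma hyperspace_dist_triangle (B A C : H) :
  hyperspace_dist A C <= hyperspace_dist A B + hyperspace_dist B C.
Proof.
by case: A B C => [A [? ?]] [B [? ?]] [C [? ?]]; exact: hausdorff_dist_triangle.
Qed.

HB.instance Definition _ := isMetric.Build R H hyperspace_distxx
  hyperspace_dist_eq0 hyperspace_distC hyperspace_dist_triangle.

End hyperspace_metric.

Definition omega_limit (R : realType) (X : metricType R) (f : X -> X) (x : X) :
    set X :=
  [set y | exists n_ : nat -> nat,
     n_ @ \oo --> \oo /\ mdist (iter (n_ i) f x) y @[i --> \oo] --> (0 : R)].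

Section omega_limit_theory.
Context (R : realType) (X : metricType R) (f : X -> X).

Lemma omega_limitP x y : omega_limit f x y <->
  forall (e : R) (N : nat), 0 < e ->
    exists2 n, (N <= n)%N & mdist (iter n f x) y < e.
Proof.
split=> [[n_ [n_oo n_y]] e N e0|h].
  have /n_oo : \forall n \near \oo, (N <= n)%N by exact: nbhs_infty_ge.
  move=> n_N.
  have n_e : \forall i \near \oo, `|0 - mdist (iter (n_ i) f x) y| < e.
    exact: (cvgrPdist_lt _ _).1 n_y e e0.
  have [i [/= ie iN]] := filter_ex (filterI n_e n_N).
  by exists (n_ i) => //; move: ie; rewrite sub0r normrN ger0_norm ?mdist_ge0.
have /choice[n_ n_P] : forall i, exists n,
    (i <= n)%N /\ mdist (iter n f x) y < i.+1%:R^-1.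
  move=> i; have i0 : (0 : R) < i.+1%:R^-1 by rewrite invr_gt0.
  by have [n] := h _ i i0; exists n.
exists n_; split.
  move=> P [N _ NP]; exists N => // i /= Ni; apply: NP => /=.
  exact: leq_trans Ni (n_P i).1.
apply: (@squeeze_cvgr _ _ _ _ (fun=> 0) (fun i => i.+1%:R^-1)).
- by near=> i; rewrite mdist_ge0 ltW// (n_P i).2.
- exact: cvg_cst.
- exact: cvg_harmonic.
Unshelve. all: end_near. Qed.

Lemma omega_limit_closed x : closed (omega_limit f x).
Proof.
move=> y cly; apply/omega_limitP => e N e0.
have e20 : 0 < e / 2 by rewrite divr_gt0.
have [z [/omega_limitP xz]] := cly _ (nbhsx_ballx y _ e20).
rewrite ballEmdist /= metric_sym => zy.
have [n Nn nz] := xz _ N e20; exists n => //.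
rewrite (le_lt_trans (metric_triangle _ z _))//.
by rewrite (splitr e) ltrD.
Qed.

Lemma omega_limit_nonempty x : compact [set: X] -> omega_limit f x !=set0.
Proof.
move=> cX; have [|y [_ cly]] := cX ((fun n => iter n f x) @ \oo) _.
  exact: filterT.
exists y; apply/omega_limitP => e N e0.
have [|z [[n /= Nn <-]]] := cly [set iter n f x | n in [set n | (N <= n)%N]] _ _ (nbhsx_ballx y _ e0).
  by exists N => // n /= Nn; exists n.
by rewrite ballEmdist /= metric_sym => ny; exists n.
Qed.

End omega_limit_theory.

Definition omega_map (R : realType) (X : metricType R) (cX : compact [set: X])
    (f : X -> X) (x : X) : hyperspace cX :=
  exist _ (omega_limit f x)
    (conj (omega_limit_nonempty f x cX) (@omega_limit_closed R X f x)).

(* Main.v *)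
Require Import Defs.
From mathcomp Require Import all_boot all_order all_algebra.
From mathcomp Require Import all_classical all_reals.
From mathcomp Require Import topology normedtype sequences.

(* Fix a set U with finite boundary.  A connected set on which membership in U
   is not constant meets the boundary of U, and only finitely many pairwise
   disjoint sets can do so.  Hence, for sufficiently many indices i such that the
   points f^i q are distinct, any y close enough to q satisfies, for every
   integer n, that f^(n+i) y and f^(n+i) q lie on the same side of U for at least
   one of these i.
   - With n negative, this shows that every omega-limit point of any orbit is
     recurrent under f^-1, hence also under f.
   - If p is in omega(x), then p is recurrent, so there are infinitely many n for
     which x visits a neighbourhood U of p at all times n + i with i in a given
     finite set; a point y close to x must also visit U at one of these times.
   - Suppose that p is not in omega(x) but is a limit of points q of omega(y) as
     y tends to x.  If p were recurrent, y would visit some U at all times n + i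
     while x eventually avoids U.  So p is not recurrent, whereas every such q is:
     the images of a small connected set containing p and q meet the boundary of
     a neighbourhood of p infinitely often.  This makes p an omega-limit point
     under f^-1 of a boundary point, hence recurrent, a contradiction.
   That omega(x) is infinite enters only through x not being periodic. *)

Set Implicit Arguments.
Unset Strict Implicit.
Unset Printing Implicit Defensive.

Import Order.TTheory GRing.Theory Num.Theory.
Import numFieldNormedType.Exports.

Local Open Scope classical_set_scope.
Local Open Scope ring_scope.

(** * Iterates of an invertible map *)

Section orbits.
Context (T : Type).
Implicit Types (f g : T -> T) (x : T).

Lemma iterK f g n : cancel f g -> cancel (iter n f) (iter n g).
Proof. by move=> fK; elim: n => // n IH x; rewrite iterSr iterS fK IH. Qed.

Lemma iterB f g a k x : cancel f g -> (a <= k)%N ->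
  iter k g (iter a f x) = iter (k - a) g x.
Proof. by move=> fK ak; rewrite -{1}(subnK ak) iterD iterK. Qed.

Lemma iterC f a b x : iter a f (iter b f x) = iter b f (iter a f x).
Proof. by rewrite -!iterD addnC. Qed.

Lemma orbit_injective f g x : cancel f g ->
  (forall d, (0 < d)%N -> iter d f x <> x) -> injective (fun n => iter n f x).
Proof.
move=> fK aper a b; wlog ab : a b / (a <= b)%N => [wl eab|eab].
  have [h|/ltnW h] := leqP a b; first exact: wl.
  by apply/esym/wl.
have per : iter (b - a) f x = x.
  by apply: (can_inj (iterK a fK)); rewrite eab -iterD subnKC.
have [/eqP|ba] := posnP (b - a)%N; last by case: (aper _ ba).
by rewrite subn_eq0 => ba; apply/eqP; rewrite eqn_leq ab.
Qed.

End orbits.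

Lemma iter_continuous (T : topologicalType) (f : T -> T) n :
  continuous f -> continuous (iter n f).
Proof.
move=> cf; elim: n => [|n IH] x /=; first exact: cvg_id.
by apply: continuous_comp; [exact: IH|exact: cf].
Qed.

Lemma frequently_injection (P : nat -> Prop) r :
  (forall N, exists2 n, (N <= n)%N & P n) ->
  exists m : 'I_r -> nat, injective m /\ forall i, P (m i).
Proof.
move=> fP.
have [s [us sr sP]] : exists s : seq nat,
    [/\ uniq s, size s = r & forall n, n \in s -> P n].
  elim: r => [|r [s [us sr sP]]]; first by exists [::].
  (* An index beyond the maximum of [s] is new. *)
  have [n sn Pn] := fP (\max_(i <- s) i).+1.
  exists (n :: s); split => /=; last 2 first.
  - by rewrite sr.
  - by move=> k; rewrite inE => /orP[/eqP->|/sP].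
  rewrite us andbT; apply/negP => ns.
  by move: sn; rewrite ltnNge (big_rem n ns)/= leq_maxl.
exists (fun i => nth 0%N s i); split => [i j /eqP|i].
  by rewrite nth_uniq ?sr// => /eqP/val_inj.
by apply: sP; rewrite mem_nth// sr.
Qed.

(** * Omega-limit sets through neighbourhoods and visiting times *)

Section omega_limit_topology.
Context (R : realType) (X : metricType R).
Implicit Types (f g : X -> X) (x y p : X).

Lemma omega_limit_nbhsP f x y : omega_limit f x y <->
  forall V N, nbhs y V -> exists2 n, (N <= n)%N & V (iter n f x).
Proof.
split=> [/omega_limitP xy V N /nbhs_ballP[e /= e0 eV]|xy].
  have [n Nn ne] := xy e N e0; exists n => //; apply: eV.
  by rewrite ballEmdist /= metric_sym.
apply/omega_limitP => e N e0; have [n Nn] := xy _ N (nbhsx_ballx y e e0).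
by rewrite ballEmdist /= metric_sym; exists n.
Qed.

Lemma omega_limit_visits f x p V r : omega_limit f x p -> nbhs p V ->
  exists m : 'I_r -> nat, injective m /\ forall i, V (iter (m i) f x).
Proof.
move=> xp pV; apply: (@frequently_injection (fun n => V (iter n f x))) => N.
exact: (omega_limit_nbhsP _ _ _).1 xp V N pV.
Qed.

Lemma not_omega_limit f x y : ~ omega_limit f x y ->
  exists V N, nbhs y V /\ forall n, (N <= n)%N -> ~ V (iter n f x).
Proof.
move=> nxy; apply: contrapT => nV; apply: nxy.
apply/omega_limit_nbhsP => V N yV.
apply: contrapT => nn; apply: nV; exists V, N; split => // n Nn Vn.
by apply: nn; exists n.
Qed.

(** Otherwise the orbit of [x] would be finite, hence closed, and would contain its omega-limit
    set. *)
Lemma omega_limit_aperiodic f x d : infinite_set (omega_limit f x) ->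
  (0 < d)%N -> iter d f x <> x.
Proof.
move=> infx d0 per; apply: infx.
have finO : finite_set [set iter i f x | i in `I_d].
  exact/finite_image/finite_II.
apply: (sub_finite_set _ finO) => y xy.
have clO : closed [set iter i f x | i in `I_d].
  apply: (accessible_finite_set_closed.1 _ _ finO).
  exact/hausdorff_accessible/metric_hausdorff.
apply: clO => V yV.
have [n _ Vn] := (omega_limit_nbhsP _ _ _).1 xy V 0%N yV.
exists (iter n f x); split => //.
exists (n %% d)%N; first by rewrite /= ltn_pmod.
by rewrite {2}(divn_eq n d) addnC iterD iterM (iter_fix _ per).
Qed.

(** Compactness gives a cluster point of the sequence of visits to [K]. *)
Lemma omega_limit_meets_closed f x (K : set X) : compact [set: X] -> closed K ->
  (forall N, exists2 n, (N <= n)%N & K (iter n f x)) ->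
  omega_limit f x `&` K !=set0.
Proof.
move=> cX clK fK.
have /choice[m hm] N : exists n, (N <= n)%N /\ K (iter n f x).
  by have [n] := fK N; exists n.
have [|p [_ clp]] := cX ((fun k => iter (m k) f x) @ \oo) _.
  exact: filterT.
exists p; split.
  apply/omega_limit_nbhsP => V N pV.
  have [|_ [[k /= Nk <-] Vk]] :=
    clp ((fun k => iter (m k) f x) @` [set k | (N <= k)%N]) V _ pV.
    by exists N => // k /= Nk; exists k.
  by exists (m k) => //; exact: leq_trans Nk (hm k).1.
apply: clK => V pV.
have [|_ [[k _ <-] Vk]] := clp (range (fun k => iter (m k) f x)) V _ pV.
  by exists 0%N => // k _; exists k.
by exists (iter (m k) f x); split => //; exact: (hm k).2.
Qed.


End omega_limit_topology.

(** * Connected sets and finite boundaries *)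

Lemma connected_meets_boundary (T : topologicalType) (A U : set T) :
  connected A -> A `&` U !=set0 -> A `\` U !=set0 -> A `&` boundary U !=set0.
Proof.
move=> cA AU0 [z [Az nUz]]; apply: contrapT => AB0.
(* Off the boundary, [closure U] and [interior U] cut out the same part of [A], which is thus clopen
   in [A]. *)
have cl_int t : A t -> closure U t -> interior U t.
  by move=> At clt; apply: contrapT => nt; apply: AB0; exists t.
suff AU : A `&` U = A by apply: nUz; move: Az; rewrite -AU => -[].
apply: cA => //.
- exists (interior U); first exact: open_interior.
  apply/seteqP; split=> t [At Ut]; split => //; last exact: interior_subset.
  by apply: cl_int => //; exact: subset_closure.
- exists (closure U); first exact: closed_closure.
  apply/seteqP; split=> t [At Ut]; split => //; first exact: subset_closure.
  by apply: interior_subset; exact: cl_int.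
Qed.

(* The relatively clopen pieces of [closure U] all meet the finite set
   [boundary U], so intersecting finitely many of them yields a minimal one. *)
Lemma finite_boundary_connected_nbhs (T : topologicalType) (U : set T) (x : T) :
  connected [set: T] -> open U -> U x -> finite_set (boundary U) ->
  exists C, [/\ nbhs x C, C `<=` closure U & connected C].
Proof.
move=> cT oU Ux /finite_seqP[s Bs].
pose piece A := [/\ A x, closed A & exists2 O, open O & A = closure U `&` O].
have [C [[Cx clC [O oO CO]] Cmin]] : exists C, piece C /\
    forall b A, b \in s -> piece A -> ~ A b -> ~ C b.
  elim: s {Bs} => [|b s [C [[Cx clC [O oO CO]] Cmin]]].
    exists (closure U); split=> //; split; first exact: subset_closure.
    - exact: closed_closure.
    - by exists setT; [exact: openT|rewrite setIT].
  have [[A [[Ax clA [Q oQ AQ]] nAb]]|nA] :=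
    pselect (exists A, piece A /\ ~ A b).
    exists (C `&` A); split.
      split=> //; first exact: closedI.
      by exists (O `&` Q); [exact: openI|rewrite CO AQ setIACA setIid].
    move=> d D; rewrite inE => /orP[/eqP-> _ _ [] //|ds pD nD [Cd _]].
    exact: Cmin pD nD Cd.
  exists C; split=> [|d D]; first by split=> //; exists O.
  rewrite inE => /orP[/eqP-> pD nD|]; last exact: Cmin.
  by exfalso; apply: nA; exists D.
have CsubU : C `<=` closure U by rewrite CO => t [].
exists C; split => //.
  apply: (@filterS _ _ _ (U `&` O)).
    by rewrite CO => t [/subset_closure].
  apply: open_nbhs_nbhs; split; first exact: openI.
  by move: Cx; rewrite CO => -[].
(* The complement of [A] in [C] is clopen in [C] too, so the part considered may be assumed to
   contain [x]. *)
move=> A; wlog Ax : A / A x => [wl A0 [P oP AP] [Q clQ AQ]|].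
  have [Ax|nAx] := pselect (A x); first by apply: wl => //; [exists P|exists Q].
  exfalso.
  have CA P' : A = C `&` P' -> C `\` A = C `&` ~` P'.
    by move=> ->; rewrite setDE setCI setIUr setICr set0U.
  have : C `\` A = C.
    apply: wl; first by split.
    - by exists x; split.
    - by exists (~` Q); [exact: closed_openC|exact: CA].
    - by exists (~` P); [exact: open_closedC|exact: CA].
  case: A0 => a Aa E.
  have Ca : C a by move: Aa; rewrite AP => -[].
  by move: Ca; rewrite -E => -[].
move=> _ [P oP AP] [Q clQ AQ].
have pA : piece A.
  split=> //; first by rewrite AQ; exact: closedI.
  by exists (O `&` P); [exact: openI|rewrite AP CO setIA].
pose D := C `\` A.
(* By minimality no boundary point of [U] is lost from [C] to [A], so [D] lies in [U]; this makes it
   clopen in the whole space. *)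
have DU : D `<=` U.
  move=> t [Ct nAt]; apply: contrapT => nUt.
  suff ts : t \in s by exact: Cmin ts pA nAt Ct.
  have : boundary U t.
    split; first exact: CsubU.
    by move/interior_subset.
  by rewrite Bs.
have clD : closed D.
  have -> : D = C `&` ~` P.
    by rewrite /D AP setDE setCI setIUr setICr set0U.
  by apply: closedI => //; exact: open_closedC.
have oD : open D.
  have -> : D = U `&` (O `&` ~` Q).
    apply/seteqP; split=> t.
      move=> Dt; split; first exact: DU.
      by case: Dt; rewrite AQ CO => -[? ?] nt; split => // ?; apply: nt.
    move=> [Ut [Ot nQt]]; split.
      by rewrite CO; split => //; exact: subset_closure.
    by rewrite AQ => -[].
  by apply: openI => //; apply: openI => //; exact: closed_openC.
apply/seteqP; split=> t; first by rewrite AP => -[].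
move=> Ct; apply: contrapT => nAt.
have DT : D = setT.
  apply: cT; first by exists t; split.
  - by exists D => //; rewrite setTI.
  - by exists D => //; rewrite setTI.
have : D x by rewrite DT.
by case.
Qed.

(** * Itineraries and recurrence in a regular curve *)

Section regular_curve_itineraries.
Context (R : realType) (X : metricType R).
Hypothesis regX : regular_curve X.
Implicit Types (x y z p q : X) (U V W : set X) (f g : X -> X).

Lemma regular_curve_nbhs x V : nbhs x V ->
  exists U, [/\ open_nbhs x U, U `<=` V & finite_set (boundary U)].
Proof.
rewrite nbhsE => -[O xO OV]; have [U [xU UO fU]] := regX.2 x O xO.
by exists U; split => //; exact: subset_trans OV.
Qed.

Lemma regular_curve_connected_nbhs x V : nbhs x V ->
  exists C, [/\ nbhs x C, C `<=` V & connected C].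
Proof.
move=> /(@uniform_regular X x)[W]; rewrite {1}nbhsE => -[O xO OW] WV.
have [U [[oU Ux] UO fU]] := regX.2 x O xO.
have [[_ cX _] _] := regX.
have [C [xC CU cC]] := finite_boundary_connected_nbhs cX oU Ux fU.
exists C; split => //; apply: subset_trans WV; apply: subset_trans CU _.
by apply: closure_subset; exact: subset_trans OW.
Qed.

Lemma connected_continuous_image (A : set X) f :
  connected A -> continuous f -> connected (f @` A).
Proof.
move=> cA cf; apply: connected_continuous_connected => //.
exact: continuous_subspaceT.
Qed.

(* Small connected neighbourhoods of the points [h i q] are pairwise disjoint,
   and so are their images under [phi]; each image on which [U] is not constant
   meets [boundary U], so this cannot happen for more than [#|boundary U|] many
   indices [i]. *)
Lemma itinerary_agreement U : finite_set (boundary U) ->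
  exists r, forall (h : 'I_r -> X -> X) q,
    (forall i, continuous (h i)) -> injective (fun i => h i q) ->
    \forall y \near q, forall phi, continuous phi -> injective phi ->
      exists i, U (phi (h i q)) <-> U (phi (h i y)).
Proof.
(* One index more than [s] has entries, for the pigeonhole argument. *)
move=> /finite_seqP[s Bs]; exists (size s).+1 => h q ch injh.
have [e [e0 disj]] : exists e : R, 0 < e /\ forall i j, i != j ->
    ball (h i q) e `&` ball (h j q) e = set0.
  have : \forall e \near 0^'+, forall i j, i != j ->
      e + e < mdist (h i q) (h j q).
    apply: filter_forall => i; apply: filter_forall => j.
    have [->|ij] := eqVneq i j; first exact: nearW.
    have d0 : 0 < mdist (h i q) (h j q) / 2.
      rewrite divr_gt0// lt_neqAle mdist_ge0 andbT eq_sym.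
      by apply: contra ij => /eqP/mdist_positivity/injh ->.
    near=> e => _; rewrite (splitr (mdist _ _)); apply: ltrD; near: e;
      exact: nbhs_right_lt.
  move=> /(filterI (nbhs_right_gt _))/filter_ex[e [e0 he]].
  exists e; split => // i j /he ij; apply/seteqP; split => // t [].
  rewrite !ballEmdist /= => it jt; move: ij; rewrite ltNge => /negP; apply.
  by rewrite (le_trans (metric_triangle _ t _))// ltW// ltrD// metric_sym.
have /choice[C hC] i : exists C,
    [/\ nbhs (h i q) C, C `<=` ball (h i q) e & connected C].
  by apply: regular_curve_connected_nbhs; exact: nbhsx_ballx.
have nearC : \forall y \near q, forall i, C i (h i y).
  by apply: filter_forall => i; have [+ _ _] := hC i; exact: ch.
(* The sets [C i] were chosen before [phi], so a single [y] serves all iterates, forward and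
   backward. *)
near=> y => phi cphi iphi; apply: contrapT => /forallNP dis.
have Cy : forall i, C i (h i y) by near: y.
have /choice[b hb] i : exists b, [/\ b \in s & (phi @` C i) b].
  have [nC _ cC] := hC i.
  have Cq : C i (h i q) by exact: nbhs_singleton.
  suff [b [Cb]] : (phi @` C i) `&` boundary U !=set0 by rewrite Bs; exists b.
  have cphiC := connected_continuous_image cC cphi.
  have [Uq|nUq] := pselect (U (phi (h i q))).
    apply: connected_meets_boundary => //.
      by exists (phi (h i q)); split => //; exists (h i q).
    exists (phi (h i y)); split; first by exists (h i y).
    by move=> Uy; apply: (dis i).
  apply: connected_meets_boundary => //; last first.
    by exists (phi (h i q)); split => //; exists (h i q).
  exists (phi (h i y)); split; first by exists (h i y).
  by apply: contrapT => nUy; apply: (dis i).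
have injb : injective b.
  move=> i j bij; apply/eqP; apply: contrapT => /negP ij.
  have [_ [a Ca ab]] := hb i; have [_ [c Cc cb]] := hb j.
  have [_ Ci _] := hC i; have [_ Cj _] := hC j.
  have ac : a = c by apply: iphi; rewrite ab cb.
  suff : set0 a by [].
  by rewrite -(disj i j ij); split; [exact: Ci|rewrite ac; exact: Cj].
have : (size (map b (enum 'I_(size s).+1)) <= size s)%N.
  apply: uniq_leq_size; first by rewrite map_inj_uniq// enum_uniq.
  by move=> _ /mapP[i _ ->]; have [] := hb i.
by rewrite size_map size_enum_ord ltnn.
Unshelve. all: end_near. Qed.

Lemma omega_limit_recurrent_inverse f g x q : cancel f g -> cancel g f ->
  continuous f -> continuous g -> omega_limit f x q -> omega_limit g q q.
Proof.
move=> fK gK cf cg xq; apply: contrapT => /not_omega_limit[V [N [qV nV]]].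
have [U [qU UV fU]] := regular_curve_nbhs qV.
have {}nV n : (N <= n)%N -> ~ U (iter n g q) by move=> /nV nVn /UV.
have injq : injective (fun n => iter n f q).
  apply: (orbit_injective fK) => d d0 per; apply: (nV (N * d)%N).
    by rewrite leq_pmulr.
  rewrite iterM iter_fix; first exact: qU.2.
  by rewrite -{1}per iterK.
have [r hr] := itinerary_agreement fU.
have [m [injm Um]] := omega_limit_visits r xq (open_nbhs_nbhs qU).
have [k Nk /(_ (iter k g))] := (omega_limit_nbhsP _ _ _).1 xq _
  (N + \sum_i m i)%N (hr (fun i => iter (m i) f) q
    (fun i => iter_continuous cf) (inj_comp injq injm)).
move=> [||i]; [exact: iter_continuous|exact/can_inj/iterK|].
have mk : (N + m i <= k)%N.
  by apply: leq_trans Nk; rewrite leq_add2l (bigD1 i)//= leq_addr.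
rewrite iterC (iterK k fK) (iterB _ fK); last first.
  exact: leq_trans (leq_addl _ _) mk.
move=> [_ /(_ (Um i))]; apply: nV.
by rewrite leq_subRL ?(leq_trans (leq_addl _ _) mk)// addnC.
Qed.

Lemma omega_limit_recurrent f g x q : cancel f g -> cancel g f ->
  continuous f -> continuous g -> omega_limit f x q -> omega_limit f q q.
Proof.
move=> fK gK cf cg xq.
have := omega_limit_recurrent_inverse fK gK cf cg xq.
exact: omega_limit_recurrent_inverse.
Qed.

Lemma omega_limit_frequently f g x p V : cancel f g -> cancel g f ->
  continuous f -> continuous g -> injective (fun n => iter n f x) ->
  omega_limit f x p -> nbhs p V ->
  \forall y \near x, forall N, exists2 n, (N <= n)%N & V (iter n f y).
Proof.
move=> fK gK cf cg injx xp pV.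
have [U [pU UV fU]] := regular_curve_nbhs pV.
have [r hr] := itinerary_agreement fU.
have pp := omega_limit_recurrent fK gK cf cg xp.
have [m [injm Um]] := omega_limit_visits r pp (open_nbhs_nbhs pU).
have nearU : \forall z \near p, forall i, U (iter (m i) f z).
  apply: filter_forall => i; apply: (iter_continuous cf).
  by apply: open_nbhs_nbhs; split; [exact: pU.1|exact: Um].
have := hr (fun i => iter (m i) f) x
  (fun i => iter_continuous cf) (inj_comp injx injm).
apply: filterS => y hy N.
have [n Nn Un] := (omega_limit_nbhsP _ _ _).1 xp _ N nearU.
have [i] := hy (iter n f) (iter_continuous cf) (can_inj (iterK n fK)).
rewrite iterC => -[/(_ (Un i)) Uy _].
exists (n + m i)%N; first exact: leq_trans (leq_addr _ _).
by rewrite iterD; exact: UV.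
Qed.

Lemma omega_limit_near_closed f g x p : cancel f g -> cancel g f ->
  continuous f -> continuous g -> injective (fun n => iter n f x) ->
  ~ omega_limit f x p ->
  \forall q \near p & y \near x, ~ omega_limit f y q.
Proof.
move=> fK gK cf cg injx nxp; apply: contrapT => nnear.
have {}nnear V Q : nbhs x V -> nbhs p Q ->
    exists y q, [/\ V y, nbhs q Q & omega_limit f y q].
  move=> xV pQ; apply: contrapT => nyq; apply: nnear.
  exists (interior Q, V) => /=; first by split => //; exact: nbhs_interior.
  by move=> [q y] /= [Qq Vy] yq; apply: nyq; exists y, q.
have npp : ~ omega_limit f p p.
  move=> pp; have [V [N [pV nV]]] := not_omega_limit nxp.
  have [U [pU UV fU]] := regular_curve_nbhs pV.
  have [r hr] := itinerary_agreement fU.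
  have [m [injm Um]] := omega_limit_visits r pp (open_nbhs_nbhs pU).
  have nearU : \forall z \near p, forall i, U (iter (m i) f z).
    apply: filter_forall => i; apply: (iter_continuous cf).
    by apply: open_nbhs_nbhs; split; [exact: pU.1|exact: Um].
  have [y [q [hy qQ yq]]] := nnear _ _ (hr (fun i => iter (m i) f) x
    (fun i => iter_continuous cf) (inj_comp injx injm)) nearU.
  have [n Nn Un] := (omega_limit_nbhsP _ _ _).1 yq _ N qQ.
  have [i] := hy (iter n f) (iter_continuous cf) (can_inj (iterK n fK)).
  rewrite [X in _ <-> U X]iterC -iterD => -[_ /(_ (Un i)) /UV].
  by apply: nV; exact: leq_trans (leq_addr _ _).
have [V [N [pV nV]]] := not_omega_limit npp.
have [W [pW WV /finite_seqP[s Ws]]] := regular_curve_nbhs pV.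
suff [b gbp] : exists b, omega_limit g b p.
  by apply: npp; exact: omega_limit_recurrent_inverse gbp.
apply: contrapT => nb.
have [O [M [pO nO]]] : exists O M, nbhs p O /\
    forall b, b \in s -> forall n, (M <= n)%N -> ~ O (iter n g b).
  elim: s {Ws} => [|b s [O [M [pO nO]]]].
    by exists setT, 0%N; split => //; exact: filterT.
  have [|O' [M' [pO' nO']]] := @not_omega_limit _ _ g b p.
    by move=> gbp; apply: nb; exists b.
  exists (O `&` O'), (maxn M M'); split; first exact: filterI.
  move=> c; rewrite inE => /orP[/eqP->|cs] n;
    rewrite geq_max => /andP[Mn M'n] [].
    by move=> _; exact: nO'.
  by move=> On _; exact: nO On.
have [C [pC CO cC]] := regular_curve_connected_nbhs pO.
have [y [q [_ qCW yq]]] :=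
  nnear setT _ filterT (filterI pC (open_nbhs_nbhs pW)).
have qq := omega_limit_recurrent fK gK cf cg yq.
have [n] := (omega_limit_nbhsP _ _ _).1 qq _ (maxn N M) qCW.
rewrite geq_max => /andP[Nn Mn] [_ Wn].
have [_ [[c Cc <-]]] : (iter n f @` C) `&` boundary W !=set0.
  apply: connected_meets_boundary.
  - by apply: connected_continuous_image => //; exact: iter_continuous.
  - exists (iter n f q); split => //; exists q => //.
    by have [] := nbhs_singleton qCW.
  - exists (iter n f p); split; first by exists p => //; exact: nbhs_singleton.
    by move=> /WV; exact: nV.
rewrite Ws => /nO/(_ n Mn); apply; apply: CO.
by rewrite iterK.
Qed.

End regular_curve_itineraries.

Theorem theorem3p1 (R : realType) (X : metricType R) (f : X -> X)
    (regX : regular_curve X) (homeo_f : homeomorphism f)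
    (x : X) (inf_omega : infinite_set (omega_limit f x)) :
  {for x, continuous (omega_map (regular_curve_compact regX) f)}.
Proof.
have cX := regular_curve_compact regX.
have cov := (compact_near_coveringP _).1 cX.
have [cf [g [fK gK cg]]] := homeo_f.
have injx : injective (fun n => iter n f x).
  by apply: (orbit_injective fK) => d; exact: omega_limit_aperiodic.
have upper e : 0 < e -> \forall y \near x, forall q, omega_limit f y q ->
    exists2 p, omega_limit f x p & mdist q p < e.
  move=> e0.
  suff: \forall y \near x, [set: X] `<=` (fun q => omega_limit f y q ->
      exists2 p, omega_limit f x p & mdist q p < e).
    by apply: filterS => y hy q; exact: hy.
  apply: cov => p _.
  have [xp|nxp] := pselect (omega_limit f x p).
    exists (ball p e, setT) => /=.
      by split; [exact: nbhsx_ballx|exact: filterT].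
    move=> [q y] /= [pq _] _; exists p => //.
    by move: pq; rewrite ballEmdist /= metric_sym.
  have := omega_limit_near_closed regX fK gK cf cg injx nxp.
  by apply: filterS => -[q y] /= nyq /nyq.
have lower e : 0 < e -> \forall y \near x, forall p, omega_limit f x p ->
    exists2 q, omega_limit f y q & mdist p q < e.
  move=> e0; have e20 : 0 < e / 2 by rewrite divr_gt0.
  suff: \forall y \near x, [set: X] `<=` (fun p => omega_limit f x p ->
      exists2 q, omega_limit f y q & mdist p q < e).
    by apply: filterS => y hy p; exact: hy.
  apply: cov => p _.
  have [xp|nxp] := pselect (omega_limit f x p); last first.
    exists (~` omega_limit f x, setT) => /=.
      split; last exact: filterT.
      apply: open_nbhs_nbhs; split => //.
      exact/closed_openC/omega_limit_closed.
    by move=> [q y] /= [nxq _] /nxq.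
  have /(@uniform_regular X p)[V pV Ve] := nbhsx_ballx p _ e20.
  exists (ball p (e / 2),
    [set y | forall N, exists2 n, (N <= n)%N & V (iter n f y)]) => /=.
    split; first exact: nbhsx_ballx.
    exact: (omega_limit_frequently regX fK gK cf cg injx xp pV).
  move=> [z y] /= [pz Vy] _.
  have [|q [yq /Ve pq]] :=
      @omega_limit_meets_closed _ _ f y (closure V) cX (@closed_closure _ _).
    by move=> N; have [n Nn /subset_closure] := Vy N; exists n.
  exists q => //; move: pz pq; rewrite !ballEmdist /= => pz pq.
  rewrite (le_lt_trans (metric_triangle z p q))// (splitr e) ltrD//.
  by rewrite metric_sym.
apply/cvg_ballP => e e0; have e20 : 0 < e / 2 by rewrite divr_gt0.
near=> y; rewrite ballEmdist /=.
apply: (@le_lt_trans _ _ (e / 2)); last first.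
  by rewrite ltr_pdivrMr// ltr_pMr// ltr1n.
apply: hausdorff_dist_le => //=.
- exact: omega_limit_nonempty.
- exact: omega_limit_nonempty.
- move=> p xp; have low : forall p, omega_limit f x p ->
      exists2 q, omega_limit f y q & mdist p q < e / 2 by near: y; exact: lower.
  by have [q yq /ltW] := low p xp; apply: le_trans; exact: dist_to_le.
- move=> q yq; have up : forall q, omega_limit f y q ->
      exists2 p, omega_limit f x p & mdist q p < e / 2 by near: y; exact: upper.
  by have [p xp /ltW] := up q yq; apply: le_trans; exact: dist_to_le.
Unshelve. all: end_near. Qed.
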